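(* Let $d,k\ge 1$ and let $a_1,\dots,a_k\in M_d(\mathbb{C})$ satisfy $\sum_{i=1}^k a_i^*a_i=\mathbf 1$. Let $\theta_0$ be a $d\times d$ density matrix, and let $(\Theta_n)_{n\in\mathbb{N}}$ be the quantum trajectory on $(\Omega,\Sigma,\mathbb{P}_{\theta_0})$ with initial state $\theta_0$ associated with the repeated perfect measurement given by $a_1,\dots,a_k$; that is, the Markov chain on density matrices started at $\theta_0$ with transitions $$\theta\longrightarrow \theta_i'=\frac{a_i\theta a_i^*}{\operatorname{tr}(a_i\theta a_i^* )}\quad\text{with probability } \operatorname{tr}(a_i\theta a_i^* ),\qquad i=1,\dots,k.$$ Then at least one of the following alternatives holds: (i) the paths of $(\Theta_n)_{n\in\mathbb{N}}$ purify with probability 1, i.e. for $\mathbb{P}_{\theta_0}$-almost every $\omega$ one has $\lim_{n\to\infty}\operatorname{tr}\bigl(\Theta_n(\omega)^m\bigr)=1$ for all integers $m\ge 1$; (ii) there exists an orthogonal projection $p\in M_d(\mathbb{C})$ of rank at least two such that for every $i\in\{1,\dots,k\}$ there exists $\lambda_i\ge 0$ with $$p\,a_i^*a_i\,p=\lambda_i\,p.$$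
   Context: $M_d(\mathbb{C})$ is the algebra of complex $d\times d$ matrices, $\mathbf 1$ its identity. A density matrix is a positive semidefinite matrix of trace 1. Perfect measurement: given $a_1,\dots,a_k\in M_d(\mathbb{C})$ with $\sum_i a_i^*a_i=\mathbf 1$, put $T_i(\theta)=a_i\theta a_i^*$. Let $\Omega=\{1,\dots,k\}^{\{1,2,3,\dots\}}$ be the space of infinite outcome sequences $\omega=(\omega_1,\omega_2,\dots)$, let $\Sigma$ be the $\sigma$-algebra generated by the cylinder sets $\Lambda_{i_1,\dots,i_m}=\{\omega:\omega_1=i_1,\dots,\omega_m=i_m\}$, and let $\mathbb{P}_{\theta_0}$ be the unique probability measure on $(\Omega,\Sigma)$ with $$\mathbb{P}_{\theta_0}(\Lambda_{i_1,\dots,i_m})=\operatorname{tr}\bigl(T_{i_m}\circ\cdots\circ T_{i_1}(\theta_0)\bigr).$$ The quantum trajectory is the sequence of random density matrices $$\Theta_n(\omega)=\frac{T_{\omega_n}\circ\cdots\circ T_{\omega_1}(\theta_0)}{\operatorname{tr}\bigl(T_{\omega_n}\circ\cdots\circ T_{\omega_1}(\theta_0)\bigr)},\qquad \Theta_0=\theta_0,$$ defined $\mathbb{P}_{\theta_0}$-almost surely (where the denominators are nonzero). *)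

(* Defs.v *)
From HB Require Import structures.
From mathcomp Require Import all_boot all_order all_algebra complex.
From mathcomp Require Import sesquilinear spectral.
From mathcomp Require Import all_classical all_reals all_analysis.

Set Implicit Arguments.
Unset Strict Implicit.
Unset Printing Implicit Defensive.

Import Order.TTheory GRing.Theory Num.Theory.
Import numFieldNormedType.Exports.

Local Open Scope classical_set_scope.
Local Open Scope ring_scope.
Local Open Scope sesquilinear_scope.

Section Matrices.
Context {C : numClosedFieldType} {d : nat}.
Implicit Types A p : 'M[C]_d.

(* In the partial order of C, 0 <= z says that z is real and nonnegative. *)
Definition psdmx A : Prop :=
  A^t* = A /\ forall v : 'cV[C]_d, 0 <= (v^t* *m A *m v) 0 0.

Definition density_matrix A : Prop := psdmx A /\ \tr A = 1.

Definition orthogonal_projection p : Prop := p *m p = p /\ p^t* = p.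

End Matrices.

(* The outcomes are labelled by 'I_k.+1 (there is at least one) and the
   outcome of the first measurement is w 0. *)
HB.instance Definition _ (k : nat) := isPointed.Build 'I_k.+1 ord0.

Definition cylinder (k : nat) (s : seq 'I_k.+1) : set (nat -> 'I_k.+1) :=
  [set w | mkseq w (size s) = s].

Notation outcome_space k := (g_sigma_algebraType (range (@cylinder k))).

Section Trajectory.
Context {R : realType} {d k : nat}.
Implicit Types (a : 'I_k.+1 -> 'M[R[i]]_d) (theta : 'M[R[i]]_d).

Definition perfect_measurement a : Prop :=
  \sum_(i < k.+1) (a i)^t* *m a i = 1%:M.

Definition T_ a (i : 'I_k.+1) theta : 'M[R[i]]_d := a i *m theta *m (a i)^t*.

(* T_seq a [:: i_1; ...; i_m] theta = T_ a i_m (... (T_ a i_1 theta)) *)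
Definition T_seq a (s : seq 'I_k.+1) theta : 'M[R[i]]_d :=
  foldl (fun t i => T_ a i t) theta s.

(* P is the law determined by its values on cylinders; these are real numbers,
   cast here into R[i]. *)
Definition trajectory_law a theta0 (P : probability (outcome_space k) R) :
    Prop :=
  forall s : seq 'I_k.+1,
    real_complex R (fine (P (cylinder s))) = \tr (T_seq a s theta0).

(* As 0^-1 = 0, this is 0 on the P-null set where the denominator vanishes. *)
Definition Theta a theta0 (n : nat) (w : outcome_space k) : 'M[R[i]]_d :=
  let X := T_seq a (mkseq w n) theta0 in (\tr X)^-1 *: X.

Definition purifies a theta0 (P : probability (outcome_space k) R) : Prop :=
  {ae P, forall w, forall m : nat, (1 <= m)%N ->
    (fun n => \tr (Theta a theta0 n w ^+ m)) @ \oo --> (1 : R[i]^o)}.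

End Trajectory.

(* Main.v *)
Require Import Defs.
From mathcomp Require Import all_boot all_order all_algebra complex.
From mathcomp Require Import sesquilinear spectral ring lra.
From mathcomp Require Import all_classical all_reals all_analysis.

(* For a pair of row vectors V (a 2 x d matrix), let area V be the square root
   of its Gram determinant, i.e. the norm of the wedge product.  For V
   orthonormal, area (V a_i^* ) is at most half the trace of the Gram matrix of
   V a_i^*, and these halves sum to 1; equality for all i means that every
   compression of a_i^* a_i to the span of V is scalar, which is alternative
   (ii).  So if (ii) fails, compactness and Gram-Schmidt give rho < 1 with
   sum_i area (V a_i^* ) <= rho * area V for all V, hence a factor rho ^ n when
   summing over the words of length n.  For X = N^* N, Lagrange's identity gives
   (tr X)^2 - tr X^2 = sum_{j,l} area (rows j, l of N)^2, so
   E sqrt (1 - tr Theta_n^2) <= K rho ^ n, and Borel-Cantelli yields almost sure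
   purification, exponentially fast. *)

Set Implicit Arguments.
Unset Strict Implicit.
Unset Printing Implicit Defensive.

Import Order.TTheory GRing.Theory Num.Theory.
Import numFieldNormedType.Exports.

Local Open Scope classical_set_scope.
Local Open Scope ring_scope.
Local Open Scope sesquilinear_scope.

(** * Adjoints, Gram matrices and Gram determinants *)

Section AdjointMatrices.
Context {C : numClosedFieldType}.

Lemma trmxC_mul m n p (A : 'M[C]_(m, n)) (B : 'M[C]_(n, p)) :
  (A *m B)^t* = B^t* *m A^t*.
Proof. by rewrite trmx_mul map_mxM. Qed.

Lemma det_trmxC n (A : 'M[C]_n) : \det (A^t*) = Num.conj (\det A).
Proof. by rewrite det_map_mx det_tr. Qed.

Lemma gram_diag_ge0 m n (V : 'M[C]_(m, n)) i : 0 <= (V *m V^t*) i i.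
Proof. by rewrite mxE sumr_ge0 // => j _; rewrite !mxE mul_conjC_ge0. Qed.

Lemma gram_conj m n (V : 'M[C]_(m, n)) i j :
  (V *m V^t*) j i = Num.conj ((V *m V^t*) i j).
Proof. by rewrite -{1}[V *m V^t*]trmxCK trmxC_mul trmxCK !mxE. Qed.

(** The rows of [V] may be dependent: Gram-Schmidt still yields [m] orthonormal rows, for which
    there is room as [m <= n], and the dependence only makes [L] singular. *)
Lemma schmidt_decomposition m n (V : 'M[C]_(m, n)) : (m <= n)%N ->
  exists L, exists2 S : 'M[C]_(m, n), S *m S^t* = 1%:M & V = L *m S.
Proof.
move=> le_mn; have /submxP[L VE] := schmidt_sub V.
by exists L, (schmidt V) => //; apply/unitarymxP/schmidt_unitarymx.
Qed.

Lemma det_gram_mull m n (L : 'M[C]_m) (V : 'M[C]_(m, n)) :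
  \det ((L *m V) *m (L *m V)^t*) = `|\det L| ^+ 2 * \det (V *m V^t*).
Proof.
rewrite trmxC_mul mulmxA -(mulmxA L) !det_mulmx det_trmxC normCK.
by rewrite mulrAC.
Qed.

(** The Gram matrix has size [m] but rank at most [n]. *)
Lemma det_gram_tall m n (V : 'M[C]_(m, n)) :
  (n < m)%N -> \det (V *m V^t*) = 0.
Proof.
move=> lt_nm; have [//|det0] := eqVneq (\det (V *m V^t*)) 0.
have: V *m V^t* \in unitmx by rewrite unitmxE unitfE.
move=> /mxrank_unit rk; move: lt_nm; rewrite ltnNge -{1}rk.
by rewrite (leq_trans (mxrankM_maxl _ _) (rank_leq_col _)).
Qed.

Lemma det_gram_ge0 m n (V : 'M[C]_(m, n)) : 0 <= \det (V *m V^t*).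
Proof.
have [le_mn|lt_nm] := leqP m n; last by rewrite det_gram_tall.
have [L [S SS ->]] := schmidt_decomposition V le_mn.
by rewrite det_gram_mull SS det1 mulr1 exprn_ge0.
Qed.

Lemma det_mx22 (A : 'M[C]_2) : \det A = A 0 0 * A 1 1 - A 0 1 * A 1 0.
Proof.
rewrite (expand_det_row _ 0) !big_ord_recl big_ord0 addr0 /cofactor !det_mx11.
rewrite !mxE /= expr0 mul1r expr1 mulN1r mulrN.
congr (_ * A _ _ - A _ _ * A _ _); exact/val_inj.
Qed.

Lemma det_gram22 n (V : 'M[C]_(2, n)) :
  \det (V *m V^t*) =
  (V *m V^t*) 0 0 * (V *m V^t*) 1 1 - `|(V *m V^t*) 0 1| ^+ 2.
Proof. by rewrite det_mx22 (gram_conj _ 0 1) normCK. Qed.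

End AdjointMatrices.

(** * The area of a pair of vectors compared with half the trace of its Gram matrix *)

Section Area.
Context {R : realType}.
Local Notation C := R[i].
Local Notation ReR := (@complex.Re R).

Lemma ge0_ReE (z : C) : 0 <= z -> z = (ReR z)%:C%C.
Proof. by move/ger0_real/RRe_real. Qed.

Lemma Re_ge0 (z : C) : 0 <= z -> 0 <= ReR z.
Proof. by rewrite lecE => /andP[_]. Qed.

Definition area n (V : 'M[C]_(2, n)) : R := Num.sqrt (ReR (\det (V *m V^t*))).

Lemma area_ge0 n (V : 'M[C]_(2, n)) : 0 <= area V.
Proof. exact: sqrtr_ge0. Qed.

Lemma sqr_area n (V : 'M[C]_(2, n)) : area V ^+ 2 = ReR (\det (V *m V^t*)).
Proof. by rewrite sqr_sqrtr // Re_ge0 // det_gram_ge0. Qed.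

(** This scaling rule reduces the contraction estimate for arbitrary pairs to orthonormal ones. *)
Lemma area_mull n (L : 'M[C]_2) (V : 'M[C]_(2, n)) :
  area (L *m V) = ComplexField.Normc.normc (\det L) * area V.
Proof.
rewrite /area det_gram_mull; have := det_gram_ge0 V.
move=> /ge0_ReE ->; rewrite [`|_|]normc_def.
rewrite -rmorphXn -rmorphM /= sqrtrM ?sqr_ge0 // sqrtr_sqr.
rewrite ger0_norm ?sqrtr_ge0 //.
by case: (\det L).
Qed.

Lemma area_tall n (V : 'M[C]_(2, n)) : (n < 2)%N -> area V = 0.
Proof. by move=> n2; rewrite /area det_gram_tall // sqrtr0. Qed.

Lemma sqr_area_gram n (V : 'M[C]_(2, n)) :
  area V ^+ 2 = ReR ((V *m V^t*) 0 0) * ReR ((V *m V^t*) 1 1)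
                - ReR `|(V *m V^t*) 0 1| ^+ 2.
Proof.
rewrite sqr_area det_gram22.
have /ge0_ReE -> := gram_diag_ge0 V 0; have /ge0_ReE -> := gram_diag_ge0 V 1.
have /ge0_ReE -> := normr_ge0 ((V *m V^t*) 0 1).
by rewrite -rmorphXn -rmorphM -rmorphB.
Qed.

Lemma Re_tr_gram n (V : 'M[C]_(2, n)) :
  ReR (\tr (V *m V^t*)) = ReR ((V *m V^t*) 0 0) + ReR ((V *m V^t*) 1 1).
Proof.
rewrite /mxtrace !big_ord_recl big_ord0 addr0.
rewrite (_ : lift _ _ = 1); last exact/val_inj.
by case: (_ 0 0) (_ 1 1) => ? ? [].
Qed.

(** With diagonal entries x, y of the Gram matrix and off-diagonal modulus z, the squares of the two
    sides differ by ((x - y) / 2)^2 + z^2. *)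
Lemma area_le_tr n (V : 'M[C]_(2, n)) :
  area V <= ReR (\tr (V *m V^t*)) / 2.
Proof.
have := sqr_area_gram V; rewrite Re_tr_gram.
have := Re_ge0 (gram_diag_ge0 V 0); have := Re_ge0 (gram_diag_ge0 V 1).
set x := ReR ((V *m V^t*) 0 0); set y := ReR ((V *m V^t*) 1 1).
set z := ReR (`|_|) => y0 x0 E.
rewrite -(@ler_pXn2r _ 2) ?nnegrE ?area_ge0 ?divr_ge0 ?addr_ge0 //.
have -> : ((x + y) / 2) ^+ 2 =
    x * y - z ^+ 2 + ((x - y) / 2) ^+ 2 + z ^+ 2 by field.
by rewrite E -addrA lerDl addr_ge0 ?sqr_ge0.
Qed.

(** In the case of equality the two squares ((x - y) / 2)^2 and z^2 sum to 0, so both vanish: x = y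
    and z = 0. *)
Lemma area_eq_tr n (V : 'M[C]_(2, n)) :
  area V = ReR (\tr (V *m V^t*)) / 2 -> V *m V^t* = ((V *m V^t*) 0 0)%:M.
Proof.
move=> areaE; have := sqr_area_gram V; rewrite areaE Re_tr_gram.
have E0 := ge0_ReE (gram_diag_ge0 V 0); have E1 := ge0_ReE (gram_diag_ge0 V 1).
have E01 := ge0_ReE (normr_ge0 ((V *m V^t*) 0 1)).
have E10 := gram_conj V 0 1.
set x := ReR ((V *m V^t*) 0 0) in E0 *; set y := ReR ((V *m V^t*) 1 1) in E1 *.
set z := ReR (`|_|) in E01 *; move=> E.
have xyz : ((x - y) / 2) ^+ 2 + z ^+ 2 = 0.
  by rewrite -[RHS](subrr (((x + y) / 2) ^+ 2)) {2}E; field.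
have xy0 : ((x - y) / 2) ^+ 2 = 0.
  by apply/eqP; move/eqP: xyz; rewrite paddr_eq0 ?sqr_ge0 // => /andP[].
have z20 : z ^+ 2 = 0 by rewrite -xyz xy0 add0r.
have xy : x = y.
  apply/eqP; move/eqP: xy0.
  by rewrite sqrf_eq0 mulf_eq0 invr_eq0 pnatr_eq0 orbF subr_eq0.
have z0 : z = 0 by apply/eqP; rewrite -sqrf_eq0 z20.
have {}E01 : (V *m V^t*) 0 1 = 0 by apply/eqP; rewrite -normr_eq0 E01 z0.
have ord2 (i : 'I_2) : i = 0 \/ i = 1.
  by case: i => -[|[|//]] ?; [left|right]; exact/val_inj.
apply/matrixP => i j; rewrite [RHS]mxE.
have [->|->] := ord2 i; have [->|->] := ord2 j; rewrite ?mulr1n ?mulr0n //.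
  by rewrite E10 E01 conjC0.
by rewrite E0 E1 xy.
Qed.

End Area.

(** * Strict decrease of the total area of one orthonormal pair *)

Section Contraction.
Context {R : realType}.
Local Notation C := R[i].
Local Notation ReR := (@complex.Re R).
Local Notation ImR := (@complex.Im R).

Lemma Re_sum (I : Type) (r : seq I) (Q : pred I) (F : I -> C) :
  ReR (\sum_(i <- r | Q i) F i) = \sum_(i <- r | Q i) ReR (F i).
Proof. by elim/big_rec2: _ => [|i y x _ <-] //; case: (F i) x => ? ? []. Qed.

Lemma Im_sum (I : Type) (r : seq I) (Q : pred I) (F : I -> C) :
  ImR (\sum_(i <- r | Q i) F i) = \sum_(i <- r | Q i) ImR (F i).
Proof. by elim/big_rec2: _ => [|i y x _ <-] //; case: (F i) x => ? ? []. Qed.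

Section Measurement.
Context {d k : nat} (a : 'I_k.+1 -> 'M[C]_d).
Hypothesis ha : perfect_measurement a.

Definition scalar_compression : Prop :=
  exists p : 'M[R[i]]_d,
    [/\ orthogonal_projection p, (2 <= \rank p)%N &
        forall i : 'I_k.+1, exists2 lambda : R[i], 0 <= lambda &
          p *m (a i)^t* *m a i *m p = lambda *: p].

Lemma sum_tr_gram m (V : 'M[C]_(m, d)) :
  \sum_i \tr ((V *m (a i)^t*) *m (V *m (a i)^t*)^t*) = \tr (V *m V^t*).
Proof.
rewrite -[in RHS](mulmx1 V) trmxC_mul.
rewrite (_ : _ *m _ = V *m (\sum_i (a i)^t* *m a i) *m V^t*); last first.
  by rewrite ha trmx1 map_mx1 mul1mx.
rewrite mulmx_sumr mulmx_suml raddf_sum /=.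
by apply: eq_bigr => i _; rewrite trmxC_mul trmxCK !mulmxA.
Qed.

(** By contraposition: the half traces sum to 1, so a total area of at least 1 makes all the
    nonnegative differences vanish. Every Gram matrix of [S *m (a i)^t*] is then scalar by
    [area_eq_tr]. *)
Lemma sum_area_lt1 (S : 'M[C]_(2, d)) : ~ scalar_compression ->
  S *m S^t* = 1%:M -> \sum_i area (S *m (a i)^t*) < 1.
Proof.
move=> nex SS; rewrite ltNge; apply/negP => ge1; apply: nex.
have half i : 0 <= ReR (\tr ((S *m (a i)^t*) *m (S *m (a i)^t*)^t*)) / 2
                   - area (S *m (a i)^t*).
  by rewrite subr_ge0 area_le_tr.
have sum0 : \sum_i (ReR (\tr ((S *m (a i)^t*) *m (S *m (a i)^t*)^t*)) / 2
                   - area (S *m (a i)^t*)) = 0.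
  apply/eqP; rewrite eq_le andbC sumr_ge0 /=; last by move=> i _; exact: half.
  rewrite sumrB subr_le0 -mulr_suml -Re_sum sum_tr_gram SS mxtrace1.
  rewrite (le_trans _ ge1) //.
  by rewrite (_ : ReR _ = 2) ?divff // -(rmorph_nat (real_complex R)).
have areaE i : area (S *m (a i)^t*) =
    ReR (\tr ((S *m (a i)^t*) *m (S *m (a i)^t*)^t*)) / 2.
  by apply/esym/eqP; rewrite -subr_eq0; apply/eqP; exact: (psumr_eq0P _ sum0).
(* As the rows of [S] are orthonormal, p = S^* S is an orthogonal projection; S p S^* = 1 bounds its
   rank below by 2. *)
exists (S^t* *m S); split.
- by split; rewrite ?trmxC_mul ?trmxCK // mulmxA -(mulmxA (S^t*)) SS mulmx1.
- apply: (@leq_trans (\rank (S *m (S^t* *m S) *m S^t*))).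
    by rewrite mulmxA SS mul1mx SS mxrank1.
  by rewrite (leq_trans (mxrankM_maxl _ _)) // mxrankM_maxr.
(* The scalar is the common diagonal entry of the Gram matrix S a_i^* a_i S^*, which sits in the
   middle of p a_i^* a_i p. *)
move=> i; exists (((S *m (a i)^t*) *m (S *m (a i)^t*)^t*) 0 0).
  exact: gram_diag_ge0.
have := area_eq_tr (areaE i); move: (_ 0 0) => lam.
rewrite trmxC_mul trmxCK => E.
rewrite -[LHS]/(S^t* *m S *m (a i)^t* *m a i *m (S^t* *m S)).
rewrite (_ : _ *m (S^t* *m S) =
  S^t* *m (S *m (a i)^t* *m (a i *m S^t*)) *m S); last by rewrite !mulmxA.
by rewrite E mul_mx_scalar -scalemxAl.
Qed.

End Measurement.
End Contraction.

(** * Continuity of complex matrix expressions and of the area *)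

Section Continuity.
Context {R : realType}.
Local Notation C := R[i].
Local Notation ReR := (@complex.Re R).
Local Notation ImR := (@complex.Im R).

Section ComplexValued.
Context {T : topologicalType}.
Implicit Types f g : T -> C.

(* Continuity is taken coordinatewise because the compactness argument takes
   place in a space of real row vectors. *)
Definition ccontinuous f : Prop :=
  continuous (ReR \o f) /\ continuous (ImR \o f).

Lemma ccontinuousM f g : ccontinuous f -> ccontinuous g ->
  ccontinuous (fun x => f x * g x).
Proof.
move=> [rf jf] [rg jg]; split.
  rewrite (_ : _ \o _ =
    (fun x => ReR (f x) * ReR (g x) - ImR (f x) * ImR (g x))).
    move=> x; apply: cvgB; apply: cvgM.
    - exact: rf.
    - exact: rg.
    - exact: jf.
    - exact: jg.
  by apply/funext => x /=; case: (f x) (g x) => ? ? [].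
rewrite (_ : _ \o _ =
  (fun x => ReR (f x) * ImR (g x) + ImR (f x) * ReR (g x))).
  move=> x; apply: cvgD; apply: cvgM.
  - exact: rf.
  - exact: jg.
  - exact: jf.
  - exact: rg.
by apply/funext => x /=; case: (f x) (g x) => ? ? [].
Qed.

Lemma continuous_sum (I : Type) (r : seq I) (F : I -> T -> R) :
  (forall i, continuous (F i)) -> continuous (fun x => \sum_(i <- r) F i x).
Proof. by move=> cF; apply: continuous_big => //; exact: add_continuous. Qed.

Lemma ccontinuous_sum n (F : 'I_n -> T -> C) : (forall i, ccontinuous (F i)) ->
  ccontinuous (fun x => \sum_i F i x).
Proof.
move=> cF; split.
  rewrite (_ : _ \o _ = (fun x => \sum_i (ReR \o F i) x)); last first.
    by apply/funext => x /=; rewrite Re_sum.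
  by apply: continuous_sum => i; exact: (cF i).1.
rewrite (_ : _ \o _ = (fun x => \sum_i (ImR \o F i) x)); last first.
  by apply/funext => x /=; rewrite Im_sum.
by apply: continuous_sum => i; exact: (cF i).2.
Qed.

Lemma ccontinuous_cst (c : C) : ccontinuous (fun=> c).
Proof. by split; exact: cst_continuous. Qed.

Lemma ccontinuousN f : ccontinuous f -> ccontinuous (fun x => - f x).
Proof.
move=> cf; rewrite (_ : (fun _ => _) = (fun x => -1 * f x)).
  exact: ccontinuousM (ccontinuous_cst _) cf.
by apply/funext => x; rewrite mulN1r.
Qed.

Lemma ccontinuousD f g : ccontinuous f -> ccontinuous g ->
  ccontinuous (fun x => f x + g x).
Proof.
move=> [rf jf] [rg jg]; split.
  rewrite (_ : _ \o _ = (fun x => ReR (f x) + ReR (g x))).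
    by move=> x; apply: cvgD; [exact: rf|exact: rg].
  by apply/funext => x /=; case: (f x) (g x) => ? ? [].
rewrite (_ : _ \o _ = (fun x => ImR (f x) + ImR (g x))).
  by move=> x; apply: cvgD; [exact: jf|exact: jg].
by apply/funext => x /=; case: (f x) (g x) => ? ? [].
Qed.

Lemma ccontinuous_conj f :
  ccontinuous f -> ccontinuous (fun x => Num.conj (f x)).
Proof.
move=> [rf jf]; split.
  by rewrite (_ : _ \o _ = ReR \o f) //; apply/funext => x /=; case: (f x).
rewrite (_ : _ \o _ = (fun x => - ImR (f x))).
  by move=> x; apply: cvgN; exact: jf.
by apply/funext => x /=; case: (f x).
Qed.

Definition mxcontinuous m n (F : T -> 'M[C]_(m, n)) : Prop :=
  forall i j, ccontinuous (fun x => F x i j).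

Lemma mxcontinuousM m n p (F : T -> 'M[C]_(m, n)) (G : T -> 'M[C]_(n, p)) :
  mxcontinuous F -> mxcontinuous G -> mxcontinuous (fun x => F x *m G x).
Proof.
move=> cF cG i j.
rewrite (_ : (fun _ => _) = fun x => \sum_l F x i l * G x l j).
  by apply: ccontinuous_sum => l; exact: ccontinuousM.
by apply/funext => x; rewrite mxE.
Qed.

Lemma mxcontinuous_trmxC m n (F : T -> 'M[C]_(m, n)) :
  mxcontinuous F -> mxcontinuous (fun x => (F x)^t*).
Proof.
move=> cF i j; rewrite (_ : (fun _ => _) = fun x => Num.conj (F x j i)).
  exact: ccontinuous_conj.
by apply/funext => x; rewrite !mxE.
Qed.

Lemma continuous_area n (F : T -> 'M[C]_(2, n)) :
  mxcontinuous F -> continuous (fun x => area (F x)).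
Proof.
move=> cF; have cG := mxcontinuousM cF (mxcontinuous_trmxC cF).
have [cdet _] : ccontinuous (fun x => \det (F x *m (F x)^t*)).
  rewrite (_ : (fun _ => _) = fun x =>
    (F x *m (F x)^t*) 0 0 * (F x *m (F x)^t*) 1 1 +
    - ((F x *m (F x)^t*) 0 1 * (F x *m (F x)^t*) 1 0)).
    by apply: ccontinuousD; last apply: ccontinuousN; apply: ccontinuousM.
  by apply/funext => x; rewrite det_mx22.
move=> x; apply: (continuous_comp (cdet x)); exact: sqrt_continuous.
Qed.

End ComplexValued.
End Continuity.

(** * Compactness of the orthonormal frames and a uniform contraction factor *)

Section Compactness.
Context {R : realType}.
Local Notation C := R[i].
Local Notation ReR := (@complex.Re R).
Local Notation ImR := (@complex.Im R).

Section Coordinates.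
Context {m n : nat}.

Definition mx_of_coords (u : 'rV[R]_(m * n + m * n)) : 'M[C]_(m, n) :=
  \matrix_(i, j) Complex (u 0 (lshift (m * n) (mxvec_index i j)))
                         (u 0 (rshift (m * n) (mxvec_index i j))).

Lemma mx_of_coords_surj (S : 'M[C]_(m, n)) : exists u, mx_of_coords u = S.
Proof.
exists (row_mx (mxvec (map_mx ReR S)) (mxvec (map_mx ImR S))).
apply/matrixP => i j; rewrite mxE row_mxEl row_mxEr !mxvecE !mxE.
by case: (S i j).
Qed.

Lemma mxcontinuous_coords : mxcontinuous mx_of_coords.
Proof.
move=> i j; split.
  rewrite (_ : _ \o _ = fun u : 'rV[R]__ =>
    u 0 (lshift (m * n) (mxvec_index i j))).
    exact: coord_continuous.
  by apply/funext => u /=; rewrite mxE.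
rewrite (_ : _ \o _ = fun u : 'rV[R]__ =>
  u 0 (rshift (m * n) (mxvec_index i j))).
  exact: coord_continuous.
by apply/funext => u /=; rewrite mxE.
Qed.

(** The Stiefel manifold of orthonormal [m]-frames in C^n, in real coordinates so that closed
    bounded sets are compact. *)
Definition orthonormal_coords : set 'rV[R]_(m * n + m * n) :=
  [set u | mx_of_coords u *m (mx_of_coords u)^t* = 1%:M].

Lemma closed_eqfun (T : topologicalType) (f : T -> R) (c : R) :
  continuous f -> closed [set x | f x = c].
Proof.
move=> cf; apply: (@closed_comp _ _ f [set c]); first by move=> x _; exact: cf.
exact: closed_eq.
Qed.

Lemma closed_orthonormal : closed orthonormal_coords.
Proof.
have cG := mxcontinuousM mxcontinuous_coords
  (mxcontinuous_trmxC mxcontinuous_coords).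
rewrite (_ : orthonormal_coords = \bigcap_(ij in [set: 'I_m * 'I_m])
  ([set u | ReR ((mx_of_coords u *m (mx_of_coords u)^t*) ij.1 ij.2)
            = ReR ((1%:M : 'M[C]_m) ij.1 ij.2)] `&`
   [set u | ImR ((mx_of_coords u *m (mx_of_coords u)^t*) ij.1 ij.2)
            = ImR ((1%:M : 'M[C]_m) ij.1 ij.2)])).
  apply: closed_bigI => -[i j] _; apply: closedI; apply: closed_eqfun.
    exact: (cG i j).1.
  exact: (cG i j).2.
apply/seteqP; split => [u Su ij _ /=|u /= H]; first by rewrite [_ *m _]Su.
apply/matrixP => i j; apply/eqP; rewrite eq_complex.
by have [/= -> ->] := H (i, j) I; rewrite !eqxx.
Qed.

(** The squared modulus is one term of the sum giving the diagonal entry 1 of [S *m S^t*]. *)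
Lemma norm_orthonormal_le1 (S : 'M[C]_(m, n)) i j :
  S *m S^t* = 1%:M -> `|S i j| <= 1.
Proof.
move=> SS; rewrite -(@ler_pXn2r _ 2) ?nnegrE // expr1n.
have /matrixP/(_ i i) := SS; rewrite !mxE eqxx mulr1n => <-.
rewrite (bigD1 j) //= !mxE -normCK lerDl.
by apply: sumr_ge0 => l _; rewrite !mxE -normCK exprn_ge0.
Qed.

Lemma bounded_orthonormal : bounded_set orthonormal_coords.
Proof.
exists 1; split => // M M1 u /= Su.
have bnd (i : 'I_m) (j : 'I_n) := norm_orthonormal_le1 i j Su.
rewrite [leLHS]/Num.Def.normr /= mx_normrE.
apply/bigmax_leP; split => [| [i0 l] _] /=.
  by rewrite (le_trans _ (ltW M1)).
apply: le_trans (ltW M1); rewrite (ord1 i0).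
have sq (x y : R) : `|Complex x y| <= 1 -> `|x| <= 1 /\ `|y| <= 1.
  rewrite normc_def lecR /= => h.
  have {h} : x ^+ 2 + y ^+ 2 <= 1.
    by rewrite -[_ + _]sqr_sqrtr ?addr_ge0 ?sqr_ge0 // expr_le1 ?sqrtr_ge0.
  move=> h; split; rewrite -(@ler_pXn2r _ 2) ?nnegrE // expr1n;
    rewrite real_normK ?num_real //; apply: le_trans h;
    by rewrite ?lerDl ?lerDr sqr_ge0.
case: (split_ordP l) => l' ->; have [i j] := mxvec_indexP l'.
  by have := bnd i j; rewrite mxE => /sq[].
by have := bnd i j; rewrite mxE => /sq[].
Qed.

Lemma compact_orthonormal : compact orthonormal_coords.
Proof.
apply: bounded_closed_compact; first exact: bounded_orthonormal.
exact: closed_orthonormal.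
Qed.

End Coordinates.

Section Contraction.
Context {d k : nat} (a : 'I_k.+1 -> 'M[C]_d).
Hypotheses (ha : perfect_measurement a) (nex : ~ scalar_compression a).

(** The total area is a continuous function on a compact set, so its maximum is attained, and
    [sum_area_lt1] applies at the maximizer. *)
Lemma orthonormal_contraction : exists2 rho : R, 0 < rho < 1 &
  forall S : 'M[C]_(2, d), S *m S^t* = 1%:M ->
    \sum_i area (S *m (a i)^t*) <= rho.
Proof.
pose f (u : 'rV[R]_(2 * d + 2 * d)) := \sum_i area (mx_of_coords u *m (a i)^t*).
have cf : continuous f.
  apply: continuous_sum => i; apply: continuous_area; apply: mxcontinuousM.
    exact: mxcontinuous_coords.
  by move=> ? ?; exact: ccontinuous_cst.
(* The extreme value theorem needs a nonempty set; for [d < 2] there is no orthonormal pair and any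
   factor will do. *)
have [K0|/set0P K0] := eqVneq (@orthonormal_coords 2 d) set0.
  exists (1 / 2) => [|S SS]; first lra.
  have [u uS] := mx_of_coords_surj S.
  have : orthonormal_coords u by rewrite /orthonormal_coords /= uS.
  by rewrite K0.
have [u uK fu] :=
  compact_EVT_max K0 compact_orthonormal (continuous_subspaceT cf).
(* The maximum with 1/2 keeps the factor positive even if [f u] is 0. *)
exists (Num.max (1 / 2) (f u)).
  rewrite lt_max gt_max; apply/and3P; split; [lra|lra|].
  by apply: sum_area_lt1 => //; move: uK; rewrite inE.
move=> S SS; have [v vS] := mx_of_coords_surj S.
rewrite le_max; apply/orP; right; rewrite -vS; apply: fu.
by rewrite inE /orthonormal_coords /= vS.
Qed.

(** Writing V = L S with [S] orthonormal, both sides scale by the modulus of det L; if [d < 2] all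
    areas are 0. *)
Lemma area_contraction : exists2 rho : R, 0 < rho < 1 &
  forall V : 'M[C]_(2, d), \sum_i area (V *m (a i)^t*) <= rho * area V.
Proof.
have [rho rho01 Hrho] := orthonormal_contraction; exists rho => // V.
have [d2|d2] := ltnP d 2.
  by rewrite area_tall // mulr0 big1 // => i _; rewrite area_tall.
have [L [S SS ->]] := schmidt_decomposition V d2.
rewrite area_mull (eq_bigr (fun i =>
  ComplexField.Normc.normc (\det L) * area (S *m (a i)^t*))); last first.
  by move=> i _; rewrite -mulmxA area_mull.
rewrite -mulr_sumr mulrCA ler_wpM2l //.
  by case: (\det L) => ? ?; exact: sqrtr_ge0.
rewrite (_ : area S = 1) ?mulr1; first exact: Hrho.
by rewrite /area SS det1 sqrtr1.
Qed.

End Contraction.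
End Compactness.

(** * Evolution along outcome words and the purity gap *)

Section Words.
Context {R : realType} {d k : nat} (a : 'I_k.+1 -> 'M[R[i]]_d).
Local Notation C := R[i].
Local Notation ReR := (@complex.Re R).

Definition act_adj (s : seq 'I_k.+1) m (V : 'M[C]_(m, d)) : 'M[C]_(m, d) :=
  foldl (fun V i => V *m (a i)^t*) V s.

(** Evolving the factor instead of the state: [T_ a i] sends W^* W to the Gram product of W a_i^*,
    so the form N^* N persists along the word. *)
Lemma T_seq_gram s m (W : 'M[C]_(m, d)) :
  T_seq a s (W^t* *m W) = (act_adj s W)^t* *m act_adj s W.
Proof.
elim: s W => //= i s IHs W; rewrite -IHs; congr foldl.
by rewrite /T_ trmxC_mul trmxCK !mulmxA.
Qed.

(** Selecting rows commutes with right multiplication; hence a pair of rows of the evolved factor is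
    an evolved pair, to which the contraction applies. *)
Lemma act_adj_rowsub s m n (f : 'I_m -> 'I_n) (W : 'M[C]_(n, d)) :
  act_adj s (rowsub f W) = rowsub f (act_adj s W).
Proof. by elim: s W => //= i s IHs W; rewrite -IHs mul_rowsub_mx. Qed.

Fixpoint words n : seq (seq 'I_k.+1) :=
  if n is n'.+1 then [seq i :: s | i <- enum 'I_k.+1, s <- words n']
  else [:: [::]].

Lemma mem_words s : s \in words (size s).
Proof.
elim: s => [|i s IHs]; first by rewrite inE.
by apply: allpairs_f => //; rewrite mem_enum.
Qed.

(** Induction on the first letter: the remaining word acts on V a_i^*, and summing over i costs one
    more factor [rho]. *)
Lemma sum_area_words rho n (V : 'M[C]_(2, d)) : 0 <= rho ->
  (forall V : 'M[C]_(2, d), \sum_i area (V *m (a i)^t*) <= rho * area V) ->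
  \sum_(s <- words n) area (act_adj s V) <= rho ^+ n * area V.
Proof.
move=> rho0 contr; elim: n V => [|n IHn] V; first by rewrite big_seq1 mul1r.
rewrite big_allpairs_dep /= big_enum /=.
apply: (@le_trans _ _ (\sum_i rho ^+ n * area (V *m (a i)^t*))).
  by apply: ler_sum => i _; exact: IHn.
by rewrite -mulr_sumr exprSr -mulrA ler_wpM2l ?exprn_ge0.
Qed.

Definition row_pair n (j l : 'I_n) (i : 'I_2) : 'I_n := if i == 0 then j else l.

(** Without normalization, so homogeneous of degree 2; for a density matrix it is 1 - tr X^2. *)
Definition purity_gap (X : 'M[C]_d) : R := ReR (\tr X ^+ 2 - \tr (X ^+ 2)).

(** With G = N N^*, the summands are the 2 x 2 minors G_jj G_ll - G_jl G_lj, which add up to (tr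
    G)^2 - tr G^2; cyclicity of the trace passes from G to N^* N. *)
Lemma purity_gap_gram (N : 'M[C]_d) :
  purity_gap (N^t* *m N) =
  \sum_j \sum_l area (rowsub (row_pair j l) N) ^+ 2.
Proof.
rewrite (eq_bigr (fun j => \sum_l ReR ((N *m N^t*) j j * (N *m N^t*) l l
                         - (N *m N^t*) j l * (N *m N^t*) l j))); last first.
  move=> j _; apply: eq_bigr => l _; rewrite sqr_area det_mx22.
  have E (i i' : 'I_2) :
      (rowsub (row_pair j l) N *m (rowsub (row_pair j l) N)^t*) i i' =
      (N *m N^t*) (row_pair j l i) (row_pair j l i').
    by rewrite !mxE; apply: eq_bigr => x _; rewrite !mxE.
  by rewrite !E.
rewrite (eq_bigr (fun j => ReR (\sum_l ((N *m N^t*) j j * (N *m N^t*) l l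
                         - (N *m N^t*) j l * (N *m N^t*) l j)))); last first.
  by move=> j _; rewrite Re_sum.
rewrite -Re_sum /purity_gap; congr ReR.
have trE : \tr ((N^t* *m N) ^+ 2) = \tr ((N *m N^t*) *m (N *m N^t*)).
  by rewrite expr2 -mulmxE mulmxA mxtrace_mulC !mulmxA.
rewrite trE [X in X ^+ 2]mxtrace_mulC; move: (N *m N^t*) => G.
under [RHS]eq_bigr do rewrite sumrB -mulr_sumr.
rewrite sumrB -mulr_suml expr2; congr (_ - _).
by apply: eq_bigr => j _; rewrite mxE.
Qed.

Lemma sum_sqr_le (I : Type) (r : seq I) (x : I -> R) : (forall i, 0 <= x i) ->
  \sum_(i <- r) x i ^+ 2 <= (\sum_(i <- r) x i) ^+ 2.
Proof.
move=> x0; elim: r => [|i r IHr]; first by rewrite !big_nil expr0n.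
rewrite !big_cons sqrrD -addrA lerD2l (le_trans IHr) // lerDr.
by rewrite mulrn_wge0 // mulr_ge0 // sumr_ge0.
Qed.

(** The l2 norm of the family of areas is at most its l1 norm, which is what the contraction
    controls. *)
Lemma sqrt_purity_gap_le (N : 'M[C]_d) :
  Num.sqrt (purity_gap (N^t* *m N)) <=
  \sum_j \sum_l area (rowsub (row_pair j l) N).
Proof.
have sum0 : 0 <= \sum_j \sum_l area (rowsub (row_pair j l) N).
  by do 2!(apply: sumr_ge0 => ? _); exact: area_ge0.
rewrite -(ger0_norm sum0) -sqrtr_sqr ler_wsqrtr // purity_gap_gram.
apply: le_trans (sum_sqr_le _ _) => [|j]; last first.
  by apply: sumr_ge0 => ? _; exact: area_ge0.
by apply: ler_sum => j _; apply: sum_sqr_le => l; exact: area_ge0.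
Qed.

(** The root of the gap has degree 1 and absorbs the probability of the word: for a state W^* W, the
    left side is the expectation of sqrt (1 - tr Theta_n^2). *)
Lemma sum_purity_gap_words rho n (W : 'M[C]_d) : 0 <= rho ->
  (forall V : 'M[C]_(2, d), \sum_i area (V *m (a i)^t*) <= rho * area V) ->
  \sum_(s <- words n) Num.sqrt (purity_gap (T_seq a s (W^t* *m W))) <=
  rho ^+ n * \sum_j \sum_l area (rowsub (row_pair j l) W).
Proof.
move=> rho0 contr.
apply: (@le_trans _ _ (\sum_(s <- words n)
    \sum_j \sum_l area (rowsub (row_pair j l) (act_adj s W)))).
  by apply: ler_sum => s _; rewrite T_seq_gram sqrt_purity_gap_le.
rewrite exchange_big mulr_sumr; apply: ler_sum => j _.
rewrite exchange_big mulr_sumr; apply: ler_sum => l _.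
under eq_bigr do rewrite -act_adj_rowsub.
exact: sum_area_words.
Qed.

End Words.

(** * Spectral facts about positive semidefinite and density matrices *)

Section DensityMatrices.
Context {C : numClosedFieldType} {d : nat}.
Implicit Types A : 'M[C]_d.

Lemma psdmx_gram m (N : 'M[C]_(m, d)) : psdmx (N^t* *m N).
Proof.
split=> [|v]; first by rewrite trmxC_mul trmxCK.
have := gram_diag_ge0 (v^t* *m N^t*) 0.
by rewrite trmxC_mul !trmxCK !mulmxA.
Qed.

Lemma psdmx_spectral A : psdmx A -> exists P : 'M[C]_d, exists2 D : 'rV[C]_d,
  P *m P^t* = 1%:M /\ (forall i, 0 <= D 0 i) & A = P^t* *m diag_mx D *m P.
Proof.
move=> [Aherm Apos].
have : A \is normalmx.
  by apply/hermitian_normalmx/is_hermitianmxP; rewrite expr0 scale1r.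
move/orthomx_spectralP; set P := spectralmx A; set D := spectral_diag A.
have /unitarymxP PP : P \is unitarymx := spectral_unitarymx A.
rewrite invmx_unitary ?spectral_unitarymx // => AE.
(* Evaluated at the i-th eigenvector, the quadratic form returns the eigenvalue [D 0 i]. *)
exists P, D => //; split => // i; have := Apos ((row i P)^t*).
have -> : ((row i P)^t*)^t* *m A *m (row i P)^t* = ((P *m A *m P^t*) i i)%:M.
  rewrite trmxCK -row_mul; apply/matrixP => u v; rewrite !ord1 [RHS]mxE mulr1n.
  by rewrite !mxE; apply: eq_bigr => j _; rewrite !mxE.
rewrite {1}AE !mulmxA PP mul1mx -mulmxA PP mulmx1 !mxE !eqxx.
by rewrite !mulr1n.
Qed.

(** Take the diagonal of square roots of the eigenvalues times the unitary. *)
Lemma psdmx_factor A : psdmx A -> exists W : 'M[C]_d, A = W^t* *m W.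
Proof.
move=> /psdmx_spectral[P [D [_ D0] ->]].
exists (diag_mx (\row_i sqrtC (D 0 i)) *m P).
rewrite trmxC_mul !mulmxA -[in RHS](mulmxA (P^t*)); congr (_ *m _ *m _).
rewrite tr_diag_mx map_diag_mx mulmx_diag; congr diag_mx; apply/rowP => i.
rewrite !mxE /= geC0_conj ?sqrtC_ge0 //.
by rewrite -expr2 sqrtCK.
Qed.

Lemma tr_spectral_exp (P : 'M[C]_d) (D : 'rV[C]_d) m : P *m P^t* = 1%:M ->
  \tr ((P^t* *m diag_mx D *m P) ^+ m) = \sum_i D 0 i ^+ m.
Proof.
move=> PP.
have -> : (P^t* *m diag_mx D *m P) ^+ m =
    P^t* *m diag_mx (\row_i D 0 i ^+ m) *m P.
  elim: m => [|m IHm].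
    rewrite (_ : diag_mx _ = 1%:M) ?mulmx1; first by rewrite expr0 (mulmx1C PP).
    by rewrite -diag_const_mx; congr diag_mx; apply/rowP => i; rewrite !mxE.
  rewrite exprS IHm -mulmxE !mulmxA -(mulmxA _ P) PP mulmx1.
  rewrite -(mulmxA (P^t*)) mulmx_diag.
  by congr (_ *m diag_mx _ *m _); apply/rowP => i; rewrite !mxE exprS.
rewrite mxtrace_mulC mulmxA PP mul1mx mxtrace_diag.
by apply: eq_bigr => i _; rewrite mxE.
Qed.

(** Reduces all powers to the square. The eigenvalues x lie in [0, 1] and sum to 1, and each of the
    [m] telescoping differences is a sum of x^(n+1) (1 - x), at most the sum of x (1 - x), that is 1
    - tr A^2. *)
Lemma density_tr_exp A m : density_matrix A ->
  0 <= 1 - \tr (A ^+ m.+1) <= (1 - \tr (A ^+ 2)) *+ m.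
Proof.
move=> [/psdmx_spectral[P [D [PP D0] ->]]].
have := tr_spectral_exp D 1 PP; rewrite expr1 => -> /=.
rewrite !tr_spectral_exp // => sumD.
have D1 i : 0 <= 1 - D 0 i.
  rewrite subr_ge0 -sumD (bigD1 i) //= !expr1 lerDl.
  by apply: sumr_ge0 => j _; rewrite expr1.
have step n : (\sum_i D 0 i ^+ n.+1) - (\sum_i D 0 i ^+ n.+2) =
    \sum_i D 0 i ^+ n.+1 * (1 - D 0 i).
  by rewrite -sumrB; apply: eq_bigr => i _; rewrite mulrBr mulr1 -exprSr.
elim: m => [|m /andP[IH0 IH1]]; first by rewrite sumD subrr mulr0n lexx.
rewrite -[1 - _](subrKA (\sum_i D 0 i ^+ m.+1)) step.
apply/andP; split.
  by apply: addr_ge0 => //; apply: sumr_ge0 => i _; rewrite mulr_ge0 ?exprn_ge0.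
rewrite mulrSr lerD //.
rewrite -[X in _ <= X - _]sumD step; apply: ler_sum => i _.
rewrite ler_wpM2r // exprS ler_piMr //.
by rewrite exprn_ile1 // -subr_ge0.
Qed.

End DensityMatrices.

(** * A Borel-Cantelli lemma and a convergence criterion *)

Section Probability.
Local Open Scope ereal_scope.

Lemma measure_bigsetU_le d (T : measurableType d) (R : realType)
    (mu : {measure set T -> \bar R}) (I : Type) (r : seq I) (Q : pred I)
    (F : I -> set T) : (forall i, measurable (F i)) ->
  mu (\big[setU/set0]_(i <- r | Q i) F i) <= \sum_(i <- r | Q i) mu (F i).
Proof.
move=> mF; elim: r => [|i r IHr]; first by rewrite !big_nil measure0.
rewrite !big_cons; case: ifP => // _.
apply: le_trans (measureU2 _ _ _) _ => //; last exact: leeD2l.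
exact: bigsetU_measurable.
Qed.

Lemma borel_cantelli_geometric d (T : measurableType d) (R : realType)
    (mu : {measure set T -> \bar R}) (F : (set T)^nat) (K q : R) :
  (forall n, measurable (F n)) -> (0 <= K)%R -> (0 < q < 1)%R ->
  (forall n, mu (F n) <= (K * q ^+ n)%:E) ->
  {ae mu, forall x, \forall n \near \oo, ~ F n x}.
Proof.
move=> mF K0 /andP[q0 q1] muF.
exists (lim_sup_set F); split.
- by apply: bigcap_measurable => // n _; exact: bigcup_measurable.
- apply: lim_sup_set_cvg0 => //.
  apply: (@le_lt_trans _ _ (K * (1 - q)^-1)%:E); last exact: ltry.
  apply: lime_le; first exact: is_cvg_nneseries.
  apply: nearW => n; apply: (@le_trans _ _ (series (geometric K q) n)%:E).
    by rewrite /series /= -sumEFin; apply: lee_sum => i _.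
  by rewrite lee_fin; apply: geometric_le_lim => //; rewrite gtr0_norm.
move=> x /= nF n _; apply: contrapT => nex; apply: nF.
by exists n => // j /= nj Fj; apply: nex; exists j.
Qed.

End Probability.

Lemma cvg_complex_dist (R : realType) (u : nat -> R[i]) (l : R[i])
    (e : nat -> R) :
  e @ \oo --> 0 -> (\forall n \near \oo, `|l - u n| <= (e n)%:C%C) ->
  u @ \oo --> (l : R[i]^o).
Proof.
move=> e0 ue; apply/(@cvgrPdist_le R[i] R[i]^o) => /= eps eps0.
(* The norm of [R[i]] takes its values in [R[i]], so [eps] is a complex number; being positive, it
   is real. *)
have epsE := ge0_ReE (ltW eps0).
have Reps0 : 0 < complex.Re eps by rewrite -ltcR -epsE.
have /cvgrPdist_le/(_ _ Reps0) e0' := e0.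
near=> n; have en : `|l - u n| <= (e n)%:C%C by near: n.
apply: le_trans en _; rewrite epsE lecR; apply: le_trans (ler_norm _) _.
by rewrite -normrN -sub0r; near: n.
Unshelve. all: by end_near. Qed.

(** * Impure outcome words and their probability *)

Section Purification.
Context {R : realType} {d k : nat} (a : 'I_k.+1 -> 'M[R[i]]_d).
Context (P : probability (outcome_space k) R).
Local Notation C := R[i].
Local Notation ReR := (@complex.Re R).

Lemma measurable_cylinder (s : seq 'I_k.+1) :
  measurable (cylinder s : set (outcome_space k)).
Proof. by apply: sub_gen_smallest; exists s. Qed.

(* Words of probability 0, where Theta is the junk value 0, count as impure. *)
Definition impure_word (W : 'M[C]_d) (q : R) n (s : seq 'I_k.+1) : bool :=
  let X := T_seq a s (W^t* *m W) in
  ~~ ((0 < ReR (\tr X)) && (purity_gap X <= (q ^+ n * ReR (\tr X)) ^+ 2)).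

(** As a finite union of cylinders it is measurable without any appeal to measurability of
    [Theta]. *)
Definition impure_event W q n : set (outcome_space k) :=
  \big[setU/set0]_(s <- words n | impure_word W q n s) cylinder s.

Lemma tr_T_seq_ge0 (W : 'M[C]_d) s :
  0 <= \tr (T_seq a s (W^t* *m W)).
Proof.
rewrite T_seq_gram mxtrace_mulC.
by apply: sumr_ge0 => i _; exact: gram_diag_ge0.
Qed.

Lemma impure_tr_le W q n s : 0 <= q -> impure_word W q n s ->
  q ^+ n * ReR (\tr (T_seq a s (W^t* *m W))) <=
  Num.sqrt (purity_gap (T_seq a s (W^t* *m W))).
Proof.
move=> q0; rewrite /impure_word /=; set X := T_seq _ _ _.
have t0 : 0 <= ReR (\tr X) := Re_ge0 (tr_T_seq_ge0 W s).
rewrite negb_and -leNgt -ltNge => /orP[t_le0|gap].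
  have /eqP -> : ReR (\tr X) == 0 by rewrite eq_le t_le0.
  by rewrite mulr0 sqrtr_ge0.
have qt0 : 0 <= q ^+ n * ReR (\tr X) by rewrite mulr_ge0 ?exprn_ge0.
by rewrite -(ger0_norm qt0) -sqrtr_sqr ler_wsqrtr // ltW.
Qed.

(** Markov's inequality at threshold q^n: of the decay q^(2n) of the expectation, one factor q^n
    pays for the threshold and the other bounds the probability. *)
Lemma impure_event_le (W : 'M[C]_d) (q K : R) n : 0 < q ->
  trajectory_law a (W^t* *m W) P ->
  \sum_(s <- words n) Num.sqrt (purity_gap (T_seq a s (W^t* *m W)))
    <= (q ^+ 2) ^+ n * K ->
  (P (impure_event W q n) <= (K * q ^+ n)%:E)%E.
Proof.
move=> q0 law sumK.
apply: le_trans (measure_bigsetU_le _ _ _ measurable_cylinder) _.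
have PE s : P (cylinder s) = (ReR (\tr (T_seq a s (W^t* *m W))))%:E.
  rewrite -law /= fineK //; apply: fin_num_measure; exact: measurable_cylinder.
rewrite (eq_bigr _ (fun s _ => PE s)).
rewrite sumEFin lee_fin -(ler_pM2l (exprn_gt0 n q0)) mulr_sumr.
apply: (@le_trans _ _ (\sum_(s <- words n | impure_word W q n s)
    Num.sqrt (purity_gap (T_seq a s (W^t* *m W))))).
  by apply: ler_sum => s; apply: impure_tr_le; exact: ltW.
apply: (@le_trans _ _ (\sum_(s <- words n)
    Num.sqrt (purity_gap (T_seq a s (W^t* *m W))))).
  rewrite [leRHS](bigID (impure_word W q n)) /= lerDl.
  by apply: sumr_ge0 => s _; exact: sqrtr_ge0.
by rewrite mulrCA mulrC -expr2 -exprM mulnC exprM.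
Qed.

Lemma good_purity (W : 'M[C]_d) (q : R) n (w : outcome_space k) m :
  ~ impure_event W q n w ->
  `|1 - \tr (Theta a (W^t* *m W) n w ^+ m.+1)| <= ((q ^+ 2) ^+ n *+ m)%:C%C.
Proof.
move=> pure; have : ~~ impure_word W q n (mkseq w n).
  apply/negP => impure; apply: pure.
  have win : mkseq w n \in words n.
    by rewrite -[X in words X](size_mkseq w) mem_words.
  rewrite /impure_event -bigcup_seq_cond.
  by exists (mkseq w n); rewrite /= ?win //= /cylinder /= size_mkseq.
rewrite negbK /Theta /=; set X := T_seq _ _ _ => /andP[t0 gap].
have tX : \tr X = (ReR (\tr X))%:C%C by apply: ge0_ReE; exact: tr_T_seq_ge0.
set t := ReR (\tr X) in t0 gap tX.
have tC0 : \tr X != 0 by rewrite tX eq_complex /= eqxx andbT gt_eqF.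
have dens : density_matrix ((\tr X)^-1 *: X).
  split; last by rewrite mxtraceZ mulVf.
  have ti0 : 0 <= (\tr X)^-1 by rewrite invr_ge0 tr_T_seq_ge0.
  have [XX X0] : psdmx X by rewrite /X T_seq_gram; exact: psdmx_gram.
  split=> [|v]; last by rewrite -scalemxAr -scalemxAl mxE mulr_ge0.
  by rewrite linearZ map_mxZ /= geC0_conj // XX.
have /andP[ge0 le1] := density_tr_exp m dens.
rewrite ger0_norm // (le_trans le1) // rmorphMn lerMn2r; apply/orP; right.
(* Taking the real part loses nothing: [X] is Hermitian, so tr X^2 = tr (X X^* ) is real, and so is
   tr X. *)
have gapE : (purity_gap X)%:C%C = \tr X ^+ 2 - \tr (X ^+ 2).
  rewrite RRe_real // rpredB ?rpredX ?ger0_real ?tr_T_seq_ge0 //.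
  have [XX _] : psdmx X by rewrite /X T_seq_gram; exact: psdmx_gram.
  rewrite expr2 -mulmxE -{2}XX.
  by apply: sumr_ge0 => i _; exact: gram_diag_ge0.
have -> : \tr (((\tr X)^-1 *: X) ^+ 2) = \tr (X ^+ 2) / \tr X ^+ 2.
  rewrite !expr2 -!mulmxE -scalemxAl -scalemxAr scalerA mxtraceZ.
  by rewrite -invfM mulrC.
have -> : 1 - \tr (X ^+ 2) / \tr X ^+ 2 = (purity_gap X)%:C%C / \tr X ^+ 2.
  by rewrite gapE mulrBl divff // expf_neq0.
rewrite ler_pdivrMr ?exprn_gt0 ?tX ?ltcR // -rmorphXn -rmorphM lecR.
by rewrite -exprM mulnC exprM -exprMn.
Qed.

End Purification.

Theorem theorem1 (R : realType) (d k : nat) (hd : (0 < d)%N)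
    (a : 'I_k.+1 -> 'M[R[i]]_d) (ha : perfect_measurement a)
    (theta0 : 'M[R[i]]_d) (htheta0 : density_matrix theta0)
    (P : probability (outcome_space k) R) (hP : trajectory_law a theta0 P) :
  purifies a theta0 P \/
  exists p : 'M[R[i]]_d,
    [/\ orthogonal_projection p, (2 <= \rank p)%N &
        forall i : 'I_k.+1, exists2 lambda : R[i], 0 <= lambda &
          p *m (a i)^t* *m a i *m p = lambda *: p].
Proof.
have [ii|nex] := pselect (scalar_compression a); [by right|left].
have [W WE] := psdmx_factor htheta0.1; rewrite WE in hP *.
have [rho /andP[rho0 rho1] contr] := area_contraction ha nex.
(* The square root splits the rate [rho] evenly between the impurity threshold and the probability
   bound, both q^n. *)
set q := Num.sqrt rho.
have q2 : q ^+ 2 = rho by rewrite sqr_sqrtr // ltW.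
have q0 : 0 < q by rewrite sqrtr_gt0.
have q1 : q < 1 by rewrite -(@ltr_pXn2r _ 2) ?nnegrE ?ltW // expr1n q2.
set K := \sum_j \sum_l area (rowsub (row_pair j l) W).
have K0 : 0 <= K by do 2!(apply: sumr_ge0 => ? _); exact: area_ge0.
have measurable_impure n : measurable (impure_event a W q n).
  by apply: bigsetU_measurable => s _; exact: measurable_cylinder.
have P_impure n : (P (impure_event a W q n) <= (K * q ^+ n)%:E)%E.
  apply: impure_event_le => //; rewrite q2.
  exact: sum_purity_gap_words (ltW rho0) contr.
have q01 : 0 < q < 1 by rewrite q0.
have := borel_cantelli_geometric measurable_impure K0 q01 P_impure.
apply: (@filterS _ _ (ae_filter_ringOfSetsType P)) => w good [//|m] _.
(* The exponent is now [m.+1], and on the good paths the distance to 1 is eventually at most m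
   rho^n. *)
apply: (@cvg_complex_dist _ _ _ (fun n => (rho ^+ n) *+ m)).
  rewrite (_ : (fun _ => _) = geometric m%:R rho).
    by apply: cvg_geometric; rewrite gtr0_norm.
  by apply/funext => n /=; rewrite mulr_natl.
by apply: filterS good => n ?; rewrite -q2; exact: good_purity.
Qed.
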